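(* Assume $\delta^*<\omega_1$ is a limit ordinal and $S\subseteq\{\delta<\omega_2:\mathrm{cf}(\delta)=\aleph_0\}$ is a stationary subset of $\omega_2$. Then there is $\bar C=\langle C_\alpha:\alpha\in S\rangle$ such that for every $\alpha\in S$: (a) $C_\alpha\subseteq S$; (b) $C_\alpha\subseteq\alpha$; (c) if $\beta\in C_\alpha$ then $\beta\in S$ and $C_\beta=C_\alpha\cap\beta$; (d) $\mathrm{otp}(C_\alpha)\le\delta^*$; and (e) for every club $E$ of $\omega_2$, the set $\{\delta\in S:\delta=\sup(C_\delta),\ \delta^*=\mathrm{otp}(C_\delta),\text{ and }C_\delta\subseteq E\}$ is a stationary subset of $\omega_2$.
   Context: $\mathrm{otp}(C)$ denotes the order type of a set $C$ of ordinals. ''Club'' means closed unbounded. The sets $C_\alpha$ are not required to be closed in $\alpha$. *)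

(* Defs.v *)
From HB Require Import structures.
From mathcomp Require Import all_boot all_order.
From mathcomp Require Import mathcomp_extra boolp classical_sets functions.
From mathcomp Require Import cardinality.
From mathcomp Require wochoice.

Set Implicit Arguments.
Unset Strict Implicit.
Unset Printing Implicit Defensive.

Import Order.TTheory.
Local Open Scope classical_set_scope.
Local Open Scope card_scope.
Local Open Scope order_scope.

(* Ordinals below omega_2 are represented by the elements of a well-ordered
   type W of order type omega_2; an ordinal a < omega_2 is identified, as usual,
   with the set [below a] of its predecessors.  The type W itself plays the role
   of omega_2, so subsets of omega_2 are terms of type [set W]. *)

Section Ordinals.
Context {d : Order.disp_t} {W : orderType d}.
Implicit Types (a b e s x y : W) (A C E : set W).

Definition below a : set W := [set x | x < a].

(* nonzero, and not a successor *)
Definition limit_ordinal a : Prop :=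
  (exists x, x < a) /\ (forall x, x < a -> exists2 y, x < y & y < a).

Definition is_omega1 a : Prop :=
  ~ countable (below a) /\ (forall x, x < a -> countable (below x)).

(* otp(A) = e : A is order isomorphic to the ordinal e *)
Definition has_otp A e : Prop :=
  exists f : W -> W, set_bij A (below e) f /\
    (forall x y, A x -> A y -> (f x < f y) = (x < y)).

Definition otp_le A e : Prop := exists2 a, a <= e & has_otp A a.

Definition cofinal_in A a : Prop :=
  A `<=` below a /\ (forall x, x < a -> exists2 y, A y & x <= y).

(* cf(a) = |K| : the least cardinality of a cofinal subset of a is that of K *)
Definition has_cof a (T : Type) (K : set T) : Prop :=
  (exists A, cofinal_in A a /\ A #= K) /\
  (forall A, cofinal_in A a -> K #<= A).

Definition unbounded A : Prop := forall x, exists2 y, A y & x < y.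

Definition closed_ordinals A : Prop :=
  forall a, limit_ordinal a -> cofinal_in (A `&` below a) a -> A a.

Definition club E : Prop := closed_ordinals E /\ unbounded E.

Definition stationary A : Prop := forall E, club E -> A `&` E !=set0.

End Ordinals.

(* W has order type omega_2, the least ordinal of cardinality greater than
   that of omega_1: W is well-ordered, it has more than aleph_1 elements, and
   all its proper initial segments have at most aleph_1 elements. *)
Definition order_type_omega2 d (W : orderType d) : Prop :=
  well_founded (fun x y : W => x < y) /\
  (exists w1 : W, [/\ is_omega1 w1,
     ~ ([set: W] #<= below w1) & forall a : W, below a #<= below w1]).

(* The notion is inhabited. *)

Lemma well_founded_least (T : Type) (R : T -> T -> Prop) (P : set T) :
  well_founded R -> P !=set0 -> exists2 x, P x & forall y, R y x -> ~ P y.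
Proof.
move=> wfR [x0 Px0]; apply: contrapT => nex.
suff: forall x, ~ P x by move/(_ x0); apply.
by elim/(well_founded_ind wfR) => x IH Px; apply: nex; exists x.
Qed.

Lemma card_le_injective (T : Type) (U : choiceType) (D : set U) (f : T -> U) :
  (forall x, D (f x)) -> injective f -> [set: T] #<= D.
Proof.
move=> Df finj; apply: (@card_le_trans _ _ _ (range f)); last first.
  by apply: subset_card_le => _ [x _ <-].
have /inj_card_eq : {in [set: T] &, injective f} by move=> x y _ _; exact: finj.
by move=> /card_eqPle[].
Qed.

Lemma countable_segments_le d (W : orderType d) (U : choiceType) (D : set U) :
  well_founded (fun x y : W => x < y) ->
  (forall a : W, countable (below a)) -> ~ countable D -> [set: W] #<= D.
Proof.
move=> wf cW nD.
have [u0 Du0] : D !=set0.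
  by apply/set0P/eqP => D0; apply: nD; rewrite D0; exact: countable0.
pose F (x : W) (g : forall y : W, y < x -> U) :=
  xget u0 (D `&` ~` [set u | exists y (h : y < x), g y h = u]).
pose f := Fix wf (fun _ => U) F.
have fE x : f x = xget u0 (D `&` ~` (f @` below x)).
  rewrite /f Fix_eq; last first.
    move=> y g1 g2 g12; congr (F y _).
    by apply: functional_extensionality_dep => z;
       apply: functional_extensionality_dep => h.
  rewrite /F; congr (xget u0 (D `&` ~` _)); apply/seteqP; split=> u.
    by move=> [y [h <-]]; exists y.
  by move=> [y h <-]; exists y, h.
have fP x : D (f x) /\ ~ (f @` below x) (f x).
  rewrite [f x]fE; case: xgetP => [u -> //|noU]; exfalso; apply: nD.
  apply: (@sub_countable _ _ _ (f @` below x)).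
    apply: subset_card_le => u Du; apply: contrapT => nu.
    by apply: (noU u).
  exact: (card_le_trans (card_image_le _ _) (cW x)).
apply: (@card_le_injective _ _ _ f) => [x|x y fxy]; first by case: (fP x).
case: (ltgtP x y) => // xy; exfalso.
  by case: (fP y) => _; apply; exists x.
by case: (fP x) => _; apply; exists y.
Qed.

Lemma exists_next_cardinal (A : Type) :
  exists (d : Order.disp_t) (W : orderType d),
  [/\ well_founded (fun x y : W => x < y), ~ ([set: W] #<= [set: A]) &
      forall a : W, below a #<= [set: A]].
Proof.
have [R Rwo] := wochoice.well_ordering_principle {classic set A}.
have Rch : wochoice.wo_chain R predT by exact: wochoice.withinW.
have Rxx x : R x x by exact: (wochoice.wo_chain_reflexive Rch).
have Ranti x y : R x y -> R y x -> x = y.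
  by move=> xy yx; apply: (wochoice.wo_chain_antisymmetric Rch) => //;
     rewrite xy yx.
have Rmin (P : set {classic set A}) : P !=set0 ->
    exists2 m, P m & forall x, P x -> R m x.
  move=> [x Px]; have [|m [[Pm mP] _]] := Rwo [pred x | `[< P x >]].
    by exists x; apply/asboolP.
  exists m; first exact/asboolP.
  by move=> y Py; apply: mP; apply/asboolP.
have Rtot x y : R x y || R y x.
  by have := wochoice.wo_chainW Rch; apply.
have Rtrans y x z : R x y -> R y z -> R x z.
  move=> xy yz.
  have [|m [[->|->]|->] mP] := Rmin ([set x] `|` [set y] `|` [set z]).
  - by exists x; left; left.
  - by apply: mP; right.
  - by rewrite (Ranti _ _ xy) //; apply: mP; left; left.
  - by rewrite -(Ranti _ _ yz) //; apply: mP; left; right.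
pose seg x : set {classic set A} := [set y | R y x /\ y <> x].
pose good x := `[< forall z, R z x -> seg z #<= [set: A] >].
pose B := {x : {classic set A} | good x}.
pose le (x y : B) := R (val x) (val y).
pose lt (x y : B) := (y != x) && le x y.
have le_anti : antisymmetric le.
  by move=> x y /andP[xy yx]; apply/val_inj/Ranti.
have le_trans : transitive le by move=> y x z; exact: Rtrans.
have le_total : total le by move=> x y; exact: Rtot.
pose dd := Order.Disp tt tt.
pose W : orderType dd :=
  HB.pack B (Order.isOrder.Build dd B
    (fun _ _ => erefl : lt _ _ = _) (fun _ _ => erefl) (fun _ _ => erefl)
    le_anti le_trans le_total).
have wf : well_founded (fun x y : W => x < y).
  move=> x0; apply: contrapT => nacc.
  have [|m [Bm nm] mP] := Rmin [set x | exists h : good x,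
     ~ Acc (fun x y : W => x < y) (exist _ x h : B)].
    by exists (val x0); case: x0 nacc => x h; exists h.
  case: nm; constructor => y /andP[neq le_ym]; apply: contrapT => ny.
  have /mP my : [set x | exists h : good x,
     ~ Acc (fun x y : W => x < y) (exist _ x h : B)] (val y).
    by case: y {neq le_ym} ny => y h; exists h.
  by move: neq => /eqP; apply; apply/val_inj/Ranti.
exists dd, W; split=> //.
  move=> W_A.
  have val_A (D : set {classic set A}) : (forall x, D x -> good x) ->
      D #<= [set: A].
    move=> Dgood; apply: (@card_le_trans _ _ _ (range (val : W -> _))).
      by apply: subset_card_le => x /Dgood h; exists (exist _ x h : B).
    exact: card_le_trans (card_image_le _ _) W_A.
  have [allgood|] := pselect (forall x, good x).
    have /pfcard_geP[T0|] := val_A setT (fun x _ => allgood x).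
      by have : [set: {classic set A}] set0 by []; rewrite T0.
    move=> /surjfunPex[f fT].
    have [a _ fa] : range f [set a | ~ f a a] by rewrite -fT.
    have : f a a <-> ~ f a a by rewrite {1}fa.
    tauto.
  move=> /existsNP[x0 ngx0].
  have [|m ngm mP] := Rmin [set x | ~ good x]; first by exists x0 => /=.
  have segm y : seg m y -> good y.
    by move=> [ym ney]; apply: contrapT => /mP my; apply/ney/Ranti.
  case: ngm; apply/asboolP => z zm.
  have [->|nzm] := pselect (z = m); first exact: val_A.
  have /asboolP := segm z (conj zm nzm).
  by apply.
move=> a; have /asboolP/(_ _ (Rxx (val a))) := valP a.
apply: card_le_trans; apply: (@card_le_trans _ _ _ (val @` below a)).
  have /inj_card_eq/card_eqPle[] // : {in below a &, injective (val : W -> _)}.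
  by move=> x y _ _; exact: val_inj.
apply: subset_card_le => _ [x /andP[nax xa] <-]; split=> //.
by move=> /val_inj xa'; move: nax; rewrite xa' eqxx.
Qed.

Lemma order_type_omega2_inhabited :
  exists (d : Order.disp_t) (W : orderType d), order_type_omega2 W.
Proof.
have [d1 [W1 [wf1 n1 c1]]] := exists_next_cardinal nat.
have [d2 [W2 [wf2 n2 c2]]] := exists_next_cardinal W1.
have [w nw cw] : exists2 w : W2, ~ countable (below w) &
    forall x, x < w -> ~ ~ countable (below x).
  apply: (well_founded_least (P := [set w | ~ countable (below w)]) wf2).
  apply: contrapT => nex; apply: n2; apply: countable_segments_le => // a.
  by apply: contrapT => na; apply: nex; exists a.
have W1w : [set: W1] #<= below w by exact: countable_segments_le.
exists d2, W2; split=> //; exists w; split.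
- by split=> // x /cw /contrapT.
- by move=> W2w; apply: n2; exact: card_le_trans W2w (c2 w).
- by move=> a; exact: card_le_trans (c2 a) W1w.
Qed.

(* Main.v *)
Require Import Defs.
From mathcomp Require Import all_boot all_order.
From mathcomp Require Import boolp classical_sets functions cardinality.

(* Club subsets of omega_2 are replaced by the sets of limit ordinals closed
   under a function h : omega_2 -> omega_2; a family of at most aleph_1 functions
   has a pointwise bound, hence the usual pigeonhole over omega_1 indices.

   Injections of each a < omega_2 into omega_1 yield, for every i < omega_1, a
   coherent system of countable sets A i a contained in a such that every
   countable subset of a lies in A i a for some i. A greedy construction shows
   that, for each club E, some d in S has a cofinal subset of S /\ E of type
   delta^*, which is then inside some A i d; fix an i that works for all E.
   Intersecting with S and with successively smaller clubs must stabilise before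
   omega_1 steps on the countable set A i d, so for some club E0 the sets
   D a = A i a /\ S /\ E0 guess clubs. A pigeonhole fixes the order type m of
   the guessing D d. Since D d has a cofinal subset of type delta^*, there is a
   cofinal increasing q : delta^* -> m, and keeping in D a only the elements b
   with otp (D b) in the range of q preserves coherence and cuts the order types
   down to delta^*. *)

Set Implicit Arguments.
Unset Strict Implicit.
Unset Printing Implicit Defensive.

Import Order.TTheory.

Section Omega2.
Local Open Scope order_scope.
Local Open Scope classical_set_scope.
Local Open Scope card_scope.

(** * Cardinality comparisons *)

Lemma inj_card_le (T U : Type) (A : set T) (D : set U) (f : T -> U) :
  (forall x, A x -> D (f x)) ->
  (forall x y, A x -> A y -> f x = f y -> x = y) -> A #<= D.
Proof.
move=> AD finj; apply: (@card_le_trans _ _ _ (f @` A)); last first.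
  by apply: subset_card_le => _ [x Ax <-]; exact: AD.
have /inj_card_eq : {in A &, injective f}.
  by move=> x y /set_mem Ax /set_mem Ay; exact: finj.
by move=> /card_eqPle[].
Qed.

Lemma card_le_inj (T U : Type) (u0 : U) (A : set T) (D : set U) : A #<= D ->
  exists f : T -> U, (forall x, A x -> D (f x)) /\
    (forall x y, A x -> A y -> f x = f y -> x = y).
Proof.
elim/Ppointed: U => U in u0 D *; first by case: (no u0).
move=> /pcard_leP[f]; exists f; split=> [x Ax|x y Ax Ay]; first exact: funS.
by apply: inj; exact: mem_set.
Qed.

Lemma countable_setU (T : Type) (A B : set T) :
  countable A -> countable B -> countable (A `|` B).
Proof.
move=> cA cB; rewrite -bigcup2E; apply: bigcup_countable => // -[|[|n]] _ //=.
Qed.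

(** Well-founded recursion gives each [x] an element of [D] not yet taken, since only countably many
    are taken before [x]. A relation on a bare type is allowed in order to cover the lexicographic
    relation in [omega1_fibres_le]. *)
Lemma wf_countable_segments_le (T : Type) (R : T -> T -> Prop) (U : choiceType)
    (D : set U) :
  well_founded R -> (forall x y, [\/ R x y, x = y | R y x]) ->
  (forall x, countable [set y | R y x]) -> ~ countable D -> [set: T] #<= D.
Proof.
move=> wfR Rtri cR nD.
have [u0 _] : D !=set0.
  by apply/set0P/eqP => D0; apply: nD; rewrite D0; exact: countable0.
pose F (x : T) (g : forall y : T, R y x -> U) :=
  xget u0 (D `&` ~` [set u | exists y (h : R y x), g y h = u]).
pose f := Fix wfR (fun _ => U) F.
have fE x : f x = xget u0 (D `&` ~` (f @` [set y | R y x])).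
  rewrite /f Fix_eq; last first.
    move=> y g1 g2 g12; congr (F y _).
    by apply: functional_extensionality_dep => z;
       apply: functional_extensionality_dep => h.
  rewrite /F; congr (xget u0 (D `&` ~` _)); apply/seteqP; split=> u.
    by move=> [y [h <-]]; exists y.
  by move=> [y h <-]; exists y, h.
have fP x : D (f x) /\ ~ (f @` [set y | R y x]) (f x).
  rewrite [f x]fE; case: xgetP => [u _ //|noU]; exfalso; apply: nD.
  apply: (@sub_countable _ _ _ (f @` [set y | R y x])).
    by apply: subset_card_le => u Du; apply: contrapT => nu; apply: (noU u).
  exact: (card_le_trans (card_image_le _ _) (cR x)).
apply: (@inj_card_le _ _ _ _ f) => [x _|x y _ _ fxy]; first by case: (fP x).
case: (Rtri x y) => // xy; exfalso.
  by case: (fP y) => _; apply; exists x.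
by case: (fP x) => _; apply; exists y.
Qed.

Context {d : Order.disp_t} {W : orderType d}.
Implicit Types (a b i j x y z : W) (h : W -> W).

Section WellOrder.
Hypothesis wf : well_founded (fun x y : W => x < y).

Lemma exists_least (P : set W) : P !=set0 ->
  exists2 x, P x & forall y, P y -> x <= y.
Proof.
move=> /(well_founded_least wf)[x Px xP]; exists x => // y Py.
by rewrite leNgt; apply/negP => /xP.
Qed.

Context {w1 : W} (omw1 : is_omega1 w1).

(** * Countable bounds in omega_1 *)

Lemma is_omega1_inj x : is_omega1 x -> x = w1.
Proof.
case: omw1 => nw cw [nx cx]; case: (ltgtP x w1) => // h; exfalso.
  exact/nx/cw.
exact/nw/cx.
Qed.

Lemma countable_below x : x < w1 -> countable (below x).
Proof. by case: omw1 => _; apply. Qed.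

Lemma countable_below_le x : x < w1 -> countable [set y | y <= x].
Proof.
move=> xw; have -> : [set y | y <= x] = below x `|` [set x].
  apply/seteqP; split=> y /=; rewrite /below /= le_eqVlt.
    by move=> /orP[/eqP->|]; [right|left].
  by move=> [->|->]; rewrite ?orbT ?eqxx.
by apply: countable_setU; [exact: countable_below|exact: countable1].
Qed.

(** Regularity of omega_1: otherwise the countable segments up to [f t], for [t] in the countable
    [B], would cover omega_1. *)
Lemma omega1_bounded (T : Type) (B : set T) (f : T -> W) : countable B ->
  (forall t, B t -> f t < w1) -> exists2 b, b < w1 & forall t, B t -> f t < b.
Proof.
move=> cB fw; apply: contrapT => nb; case: omw1 => + _; apply.
apply: (@sub_countable _ _ _ (\bigcup_(t in B) [set y | y <= f t])).
  apply: subset_card_le => x xw; apply: contrapT => nx; apply: nb; exists x => //.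
  move=> t Bt; rewrite ltNge; apply/negP => xf; apply: nx; exists t => //.
apply: bigcup_countable => // t Bt; exact/countable_below_le/fw.
Qed.

(** Numbering each fibre by naturals and comparing first by [rho], then by number, well-orders [T]
    with countable initial segments. *)
Lemma omega1_fibres_le (T : Type) (rho : T -> W) :
  (forall t, rho t < w1) -> (forall x, countable (rho @^-1` [set x])) ->
  [set: T] #<= below w1.
Proof.
move=> rw cr.
have /choice[n nP] : forall x, exists n : T -> nat,
    {in rho @^-1` [set x] &, injective n}.
  by move=> x; apply/countable_injP.
pose R s t := rho s < rho t \/ (rho s = rho t /\ (n (rho s) s < n (rho t) t)%N).
apply: (@wf_countable_segments_le _ R); last by case: omw1.
- suff: forall x m t, rho t = x -> (n x t < m)%N -> Acc R t.
    by move=> H t; exact: (H (rho t) (n (rho t) t).+1).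
  move=> x; elim/(well_founded_ind wf): x => x IH.
  elim=> [|m IHm] t tx tm.
    by rewrite ltn0 in tm.
  constructor => s [st|[st ns]].
    by apply: (IH (rho s) _ (n (rho s) s).+1) => //; rewrite -tx.
  have sx : rho s = x by rewrite st.
  by rewrite sx tx in ns; apply: IHm sx (leq_trans ns _).
- move=> s t; rewrite /R; case: (ltgtP (rho s) (rho t)) => st.
  + by apply: Or31; left.
  + by apply: Or33; left.
  + case: (ltngtP (n (rho s) s) (n (rho t) t)) => nst.
    * by apply: Or31; right.
    * by apply: Or33; right.
    * by apply: Or32; apply: (nP (rho s)); rewrite ?inE//= ?nst ?st.
- move=> t.
  apply: (@sub_countable _ _ _ (\bigcup_(x in [set y | y <= rho t]) (rho @^-1` [set x]))).
    apply: subset_card_le => s Rst; exists (rho s) => //=.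
    by case: Rst => [/ltW//|[->]].
  by apply: bigcup_countable => //; exact: countable_below_le.
Qed.

Hypothesis big : ~ ([set: W] #<= below w1).
Hypothesis seg : forall a : W, below a #<= below w1.


(** * Regularity of omega_2 and closure under functions *)

Lemma omega2_no_max x : exists y, x < y.
Proof.
apply: contrapT => nx; apply: big.
have xmax z : z <= x by rewrite leNgt; apply/negP => xz; apply: nx; exists z.
have [z0 z0w] : exists z, z < w1.
  apply: contrapT => n0; case: omw1 => + _; apply.
  by rewrite (_ : below w1 = set0)//; apply/seteqP; split=> // z zw; case: n0; exists z.
have [g [gw ginj]] := card_le_inj w1 (seg x).
pose rho z := if z < x then g z else z0.
apply: (@omega1_fibres_le _ rho) => [z|m].
  by rewrite /rho; case: ifP => // /gw.
apply: (@sub_countable _ _ _ ([set z | z < x /\ g z = m] `|` [set x])).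
  apply: subset_card_le => z /=; rewrite /rho; case: ifP => [zx gz|zx _]; first by left.
  by right; apply/eqP; rewrite eq_le xmax leNgt zx.
apply: countable_setU; last exact: countable1.
apply: (@sub_countable _ _ _ [set m]); last exact: countable1.
apply: (@inj_card_le _ _ _ _ g) => [z []//|y z [yx <-] [zx gz]].
by move=> gyz; apply: ginj.
Qed.

(** Regularity of omega_2: if [f] were unbounded on [B], each [x] would lie below some [f (t x)] and
    be coded by two countable ordinals, the index of [t x] and the code of [x] below [f (t x)]. The
    larger of the two is a map to omega_1 with countable fibres. *)
Lemma omega2_bounded (T : Type) (B : set T) (f : T -> W) : B #<= below w1 ->
  exists b, forall t, B t -> f t < b.
Proof.
move=> cB; apply: contrapT => nb; apply: big.
have [e [ew einj]] := card_le_inj w1 cB.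
have /choice[g gP] a : exists g : W -> W,
    (forall x, below a x -> below w1 (g x)) /\
    (forall x y, below a x -> below a y -> g x = g y -> x = y).
  exact: card_le_inj.
have /choice[t tP] x : exists t, B t /\ x < f t.
  have [y xy] := omega2_no_max x.
  apply: contrapT => nx; apply: nb; exists y => t Bt.
  by rewrite ltNge; apply/negP => yt; apply: nx; exists t; rewrite (lt_le_trans xy).
pose rho x := Order.max (e (t x)) (g (f (t x)) x).
have rE x : e (t x) < w1 /\ g (f (t x)) x < w1.
  by split; [apply/ew; case: (tP x)|apply: (gP _).1; case: (tP x)].
apply: (@omega1_fibres_le _ rho) => [x|m].
  by rewrite /rho gt_max; case: (rE x) => -> ->.
have [mw|mw] := ltP m w1; last first.
  apply: (@sub_countable _ _ _ (@set0 W)); last exact: countable0.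
  apply: subset_card_le => x /= xm; move: mw; rewrite leNgt -xm gt_max.
  by case: (rE x) => -> ->.
apply: (@sub_countable _ _ _ ([set y | y <= m] `*` [set y | y <= m])); last first.
  by apply: countableX; exact: countable_below_le.
apply: (@inj_card_le _ _ _ _ (fun x => (e (t x), g (f (t x)) x))).
  by move=> x /= <-; rewrite /rho /= !le_max !lexx orbT.
move=> x y _ _ [exy gxy].
have txy : t x = t y by apply: einj exy; [case: (tP x)|case: (tP y)].
rewrite -txy in gxy; apply: (gP (f (t x))).2 gxy; first by case: (tP x).
by rewrite /below /= txy; case: (tP y).
Qed.

Lemma countable_le_omega1 (T : Type) (B : set T) : countable B -> B #<= below w1.
Proof.
move=> cB; apply: card_le_trans cB _; apply/infiniteP => fw.
by case: omw1 => + _; apply; exact: finite_set_countable.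
Qed.

(* [K] stands for omega_1 or for omega_2. *)
Lemma exists_closure_point (K : set W) (g : W -> W) i :
  (forall x, K x -> exists2 b, K b & forall z, z <= x -> g z < b) ->
  (forall u : nat -> W, (forall n, K (u n)) -> exists2 b, K b & forall n, u n < b) ->
  (forall x y, K y -> x <= y -> K x) ->
  K i -> exists j, [/\ K j, i < j, limit_ordinal j & forall x, x < j -> g x < j].
Proof.
move=> Kg Ku Kd Ki.
have /choice[b bP] x : exists b, K x -> [/\ K b, x < b & forall z, z <= x -> g z < b].
  have [Kx|nK] := pselect (K x); last by exists x.
  have [b Kb bg] := Kg _ Kx; have [c Kc cx] := Ku (fun=> x) (fun=> Kx).
  exists (Order.max b c) => _; split; first by case: leP.
    by rewrite lt_max (cx 0%N) orbT.
  by move=> z zx; rewrite lt_max bg.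
(* The supremum [j] of this orbit is closed under [g]: any [x < j] is at most some [u n], hence
   [g x < u n.+1]. *)
pose u n := iter n b i.
have uK n : K (u n) by elim: n => //= n /bP[].
have uS n : u n < u n.+1 by case: (bP _ (uK n)).
have [j [uj jle]] : exists j, (forall n, u n < j) /\
    (forall x, (forall n, u n < x) -> j <= x).
  have [c _ cu] := Ku u uK.
  have [|j uj jle] := @exists_least [set x | forall n, u n < x]; first by exists c.
  by exists j.
have ju x : x < j -> exists n, x <= u n.
  move=> xj; apply: contrapT => nx; move: xj; rewrite ltNge => /negP; apply.
  by apply: jle => n; rewrite ltNge; apply/negP => xu; apply: nx; exists n.
exists j; split.
- have [c Kc cu] := Ku u uK.
  by apply: Kd Kc (jle _ cu).
- exact: (uj 0%N).
- split; first by exists i; exact: (uj 0%N).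
  move=> x /ju[n xn]; exists (u n.+1) => //; exact: le_lt_trans xn (uS n).
- move=> x /ju[n xn]; apply: lt_trans (uj n.+1).
  by case: (bP _ (uK n)) => _ _; apply.
Qed.

(** * Clubs as sets of closure points *)

Definition closure_points h : set W :=
  [set a | limit_ordinal a /\ forall x, x < a -> h x < a].

Lemma closure_points_le h h' : (forall x, h x <= h' x) ->
  closure_points h' `<=` closure_points h.
Proof. by move=> hh a [la ha]; split=> // x /ha; exact: le_lt_trans. Qed.

Lemma below_le_card x : [set y | y <= x] #<= below w1.
Proof.
have [y xy] := omega2_no_max x; apply: card_le_trans (seg y).
by apply: subset_card_le => z zx; exact: le_lt_trans zx xy.
Qed.

Lemma closure_points_unbounded h : unbounded (closure_points h).
Proof.
move=> x; have [|||//|j [_ xj lj hj]] := @exists_closure_point setT h x.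
- by move=> y _; have [b bP] := omega2_bounded h (below_le_card y); exists b.
- move=> u _; have [|b bP] := @omega2_bounded _ [set: nat] u.
    exact: countable_le_omega1.
  by exists b => // n; exact: bP.
- by [].
- by exists j.
Qed.

Lemma closure_points_club h : club (closure_points h).
Proof.
split; last exact: closure_points_unbounded.
move=> a la [_ aC]; split=> // x xa; have [y xy ya] := la.2 _ xa.
have [z [[_ zC] za] yz] := aC _ ya.
exact: lt_trans (zC _ (lt_le_trans xy yz)) za.
Qed.

(** With [h x] an element of [E] above [x], every closure point of [h] is a limit of elements of
    [E]. *)
Lemma club_closure_points E : club E -> exists h, closure_points h `<=` E.
Proof.
move=> [Ec Eu]; have /choice[h hP] x : exists y, E y /\ x < y.
  by have [y Ey xy] := Eu x; exists y.
exists h => a [la ha]; apply: Ec => //; split; first by move=> x [].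
move=> x xa; have [Ehx xh] := hP x.
by exists (h x); [split=> //; exact: ha|exact: ltW].
Qed.

(** This stands in for intersecting at most aleph_1 clubs: closure points of [h'] are closure points
    of every [h k] with [k] in [B]. *)
Lemma closure_bound (I : Type) (B : set I) (h : I -> W -> W) :
  B #<= below w1 -> exists h', forall k x, B k -> h k x <= h' x.
Proof.
move=> cB; have /choice[h' hP] x : exists b, forall k, B k -> h k x < b.
  exact: (omega2_bounded (h^~ x) cB).
by exists h' => k x Bk; exact/ltW/hP.
Qed.

(** If each index had a counterexample function, a pointwise bound of these aleph_1 functions would,
    by monotonicity of [P], fail at every index at once. *)
Lemma exists_uniform_index (P : W -> (W -> W) -> Prop) :
  (forall i h h', (forall x, h x <= h' x) -> P i h' -> P i h) ->
  (forall h, exists2 i, i < w1 & P i h) ->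
  exists2 i, i < w1 & forall h, P i h.
Proof.
move=> Pd Pe; apply: contrapT => nP.
have /choice[g gP] i : exists h, i < w1 -> ~ P i h.
  apply: contrapT => ng; apply: nP; exists i.
    by rewrite ltNge; apply/negP => wi; apply: ng; exists id; rewrite ltNge wi.
  by move=> h; apply: contrapT => nh; apply: ng; exists h.
have [h hP] := closure_bound g (card_lexx (below w1)).
have [i iw Pih] := Pe h.
by apply: (gP i iw); apply: Pd Pih => x; exact: hP.
Qed.


(* The value at [a] is only required to be related to the values below [a]. *)
Lemma exists_wf_rec (T : Type) (t0 : T) (R : W -> (W -> T) -> T -> Prop) :
  (forall a f g t, (forall b, b < a -> f b = g b) -> R a f t -> R a g t) ->
  (forall a f, exists t, R a f t) -> exists f, forall a, R a f (f a).
Proof.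
move=> Rext Rtot.
have /choice[F FP] af : exists t, R af.1 af.2 t by exact: Rtot.
pose ext a (g : forall b, b < a -> T) b :=
  if pselect (b < a) is left ba then g b ba else t0.
pose f := Fix wf (fun=> T) (fun a g => F (a, ext a g)).
have fE a : f a = F (a, ext a (fun b _ => f b)).
  rewrite /f Fix_eq // => x g1 g2 g12; congr (F (x, ext x _)).
  by apply: functional_extensionality_dep => b;
     apply: functional_extensionality_dep => ba.
exists f => a; rewrite [X in R _ _ X]fE.
apply: Rext (FP (a, _)) => b ba /=.
by rewrite /ext; case: pselect.
Qed.

(** * Coherent systems: ranks and partial squares *)

Definition coherent (C : W -> set W) : Prop :=
  forall a b, C a b -> b < a /\ C b = C a `&` below b.

Lemma coherent_setI C (X : set W) : coherent C -> coherent (fun a => C a `&` X).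
Proof.
by move=> coC a b [/coC[ba Cb] _]; split=> //; rewrite /= Cb setIAC.
Qed.

(** Recursively, [rk a] is the least ordinal that is not [rk b] for any [b] in [C a]. By coherence
    this is the order type of [C a], and [rk] maps [C a] increasingly onto the ordinals below
    [rk a]. *)
Lemma exists_rank C : coherent C -> (forall a, countable (C a)) ->
  exists rk : W -> W, forall a, [/\ rk a < w1,
    forall b, C a b -> rk b < rk a,
    forall b c, C a b -> C a c -> b < c -> rk b < rk c &
    forall x, x < rk a -> exists2 b, C a b & rk b = x].
Proof.
move=> coC cC.
pose R a (f : W -> W) x := (forall b, C a b -> f b <> x) /\
  (forall y, y < x -> exists2 b, C a b & f b = y).
have [||rk rkP] := @exists_wf_rec W w1 R.
- move=> a f g x fg [xC Cx]; split=> [b Cab|y /Cx[b Cab]].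
    by rewrite -fg; [exact: xC|case: (coC _ _ Cab)].
  by exists b => //; rewrite -fg//; case: (coC _ _ Cab).
- move=> a f; have [|x /= nx xmin] := @exists_least (~` (f @` C a)).
    apply: contrapT => n; case: omw1 => + _; apply.
    apply: (@sub_countable _ _ _ (f @` C a)); last exact: card_le_trans (card_image_le _ _) (cC a).
    apply: subset_card_le => x _; apply: contrapT => nx; apply: n; by exists x.
  exists x; split=> [b Cab fb|y yx]; first by apply: nx; exists b.
  apply: contrapT => ny; move: yx; rewrite ltNge => /negP; apply; apply: xmin.
  by move=> [b Cab fb]; apply: ny; exists b.
have rk_lt a b : C a b -> rk b < rk a.
  move=> Cab; case: (ltgtP (rk b) (rk a)) => // [ab|/((rkP a).1 b Cab)//].
  have [c Cbc cE] := (rkP b).2 _ ab.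
  have := (coC _ _ Cab).2; move=> Cb; rewrite Cb in Cbc.
  by case: ((rkP a).1 c Cbc.1).
exists rk => a; split.
- rewrite ltNge; apply/negP => wa; case: omw1 => + _; apply.
  apply: (@sub_countable _ _ _ (rk @` C a)).
    apply: subset_card_le => x xw; have [b Cab <-] := (rkP a).2 _ (lt_le_trans xw wa).
    by exists b.
  exact: card_le_trans (card_image_le _ _) (cC a).
- exact: rk_lt.
- by move=> b c Cab Cac bc; apply: rk_lt; rewrite (coC _ _ Cac).2.
- exact: (rkP a).2.
Qed.

(* Fix injections [e a] of [a] into omega_1. For club many [i < omega_1], the
   sets [[set b | b < a /\ e a b < i]] cohere below [a]. *)
Lemma exists_partial_squares : exists A : W -> W -> set W,
  [/\ forall i, coherent (A i), forall i a, i < w1 -> countable (A i a) &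
    forall a (B : set W), countable B -> B `<=` below a ->
      exists2 i, i < w1 & B `<=` A i a].
Proof.
have /choice[e eP] a : exists e : W -> W,
    (forall x, below a x -> below w1 (e x)) /\
    (forall x y, below a x -> below a y -> e x = e y -> x = y).
  exact: card_le_inj.
have ew a b : b < a -> e a b < w1 by move=> ba; apply: (eP a).1.
have einj a b c : b < a -> c < a -> e a b = e a c -> b = c.
  by move=> ba ca; apply: (eP a).2.
pose A0 i a := [set b | b < a /\ e a b < i].
(* [T i a] is coherence of [A0 i] at [a]. Where it fails the set is made empty, so that coherence
   holds for every [i]. *)
pose T i a := forall b, A0 i a b -> A0 i b = A0 i a `&` below b.
exists (fun i a => [set b | A0 i a b /\ T i a]); split.
- move=> i a b [A0b Ta]; have Tb : T i b.
    move=> c; rewrite (Ta _ A0b) => -[A0c cb]; rewrite (Ta _ A0c).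
    rewrite -setIA; congr (_ `&` _); apply/seteqP; split=> x /=; last by case.
    by move=> xc; split=> //; exact: lt_trans cb.
  split; first by case: A0b.
  apply/seteqP; split=> c /=.
    by move=> [+ _]; rewrite (Ta _ A0b) => -[].
  by move=> [[A0c _] cb]; split=> //; rewrite (Ta _ A0b).
- move=> i a iw; apply: (@sub_countable _ _ _ (below i)); last exact: countable_below.
  apply: (@inj_card_le _ _ _ _ (e a)) => [b [[]]//|b c [[ba _] _] [[ca _] _]].
  exact: einj.
move=> a B cB Ba.
have [i0 i0w Bi0] := omega1_bounded (f := e a) cB (fun t Bt => ew _ _ (Ba t Bt)).
have cX x : x < w1 -> countable ([set y | y <= x] `*` [set y | y <= x]).
  by move=> xw; apply: countableX; exact: countable_below_le.
(* The two bounds serve the two inclusions in [T]: for [c < b < a], two of the three codes [e a b],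
   [e b c], [e a c] control the remaining one. A closure point of [g] above [i0] is the required
   index. *)
have /choice[g gP] x : exists y, x < w1 -> [/\ y < w1,
    forall b c, b < a -> c < b -> e a b <= x -> e b c <= x -> e a c < y &
    forall b c, b < a -> c < b -> e a b <= x -> e a c <= x -> e b c < y].
  have [xw|wx] := ltP x w1; last by exists x.
  have [||y1 y1w y1P] := @omega1_bounded _
    [set p : W * W | [/\ p.1 < a, p.2 < p.1, e a p.1 <= x & e p.1 p.2 <= x]]
    (fun p => e a p.2).
  - apply: sub_countable (cX x xw).
    apply: (@inj_card_le _ _ _ _ (fun p => (e a p.1, e p.1 p.2))).
      by move=> p [].
    move=> [b c] [b' c'] [/= ba cb _ _] [/= b'a c'b' _ _] [/einj bb'].
    by rewrite -bb'// in c'b' * => /einj ->.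
  - by move=> [b c] [/= ba cb _ _]; apply: ew; exact: lt_trans ba.
  have [||y2 y2w y2P] := @omega1_bounded _
    [set p : W * W | [/\ p.1 < a, p.2 < p.1, e a p.1 <= x & e a p.2 <= x]]
    (fun p => e p.1 p.2).
  - apply: sub_countable (cX x xw).
    apply: (@inj_card_le _ _ _ _ (fun p => (e a p.1, e a p.2))).
      by move=> p [].
    move=> [b c] [b' c'] [/= ba cb _ _] [/= b'a c'b' _ _] [/einj bb'].
    by move=> /einj cc'; rewrite bb'// cc'//; exact: lt_trans ba || exact: lt_trans b'a.
  - by move=> [b c] [/= ba cb _ _]; exact: ew.
  exists (Order.max y1 y2) => _; split; first by rewrite gt_max y1w.
  - by move=> b c ba cb eb ec; rewrite lt_max (y1P (b, c)).
  - by move=> b c ba cb eb ec; rewrite lt_max (y2P (b, c)) ?orbT.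
have [||||j [jw ij _ jg]] := @exists_closure_point (below w1) g i0.
- move=> x xw; apply: omega1_bounded; first exact: countable_below_le.
  by move=> t tx; case: (gP t (le_lt_trans tx xw)).
- move=> u uw; have [//|n _|b bw bP] := @omega1_bounded _ [set: nat] u.
    exact: uw.
  by exists b => // n; exact: bP.
- by move=> x y yw xy; exact: le_lt_trans yw.
- by [].
exists j => // b Bb; split; first by split; [exact: Ba|exact: lt_trans (Bi0 _ Bb) ij].
move=> {Bb}b [ba eb]; apply/seteqP; split=> c.
  move=> [cb ec]; have mj : Order.max (e a b) (e b c) < j by rewrite gt_max eb.
  split=> //; split; first exact: lt_trans ba.
  have [_ + _] := gP _ (lt_trans mj jw); move=> /(_ b c ba cb).
  by rewrite !le_max !lexx orbT => /(_ isT isT)/lt_trans; apply; exact: jg.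
move=> [[ca ec] cb]; have mj : Order.max (e a b) (e a c) < j by rewrite gt_max eb.
split=> //.
have [_ _] := gP _ (lt_trans mj jw); move=> /(_ b c ba cb).
by rewrite !le_max !lexx orbT => /(_ isT isT)/lt_trans; apply; exact: jg.
Qed.

(* [A] has a subset of order type [e] that is cofinal in [a]; unlike
   [has_otp A e], this is monotone in [A]. *)
Definition cofinal_embedding (A : set W) e a : Prop := exists q : W -> W,
  [/\ forall j, j < e -> A (q j), forall j k, j < k -> k < e -> q j < q k &
      forall x, x < a -> exists2 j, j < e & x <= q j].

Lemma cofinal_embeddingS (A B : set W) e a :
  A `<=` B -> cofinal_embedding A e a -> cofinal_embedding B e a.
Proof. by move=> AB [q [qA ? ?]]; exists q; split=> // j /qA/AB. Qed.

(** * Greedy enumerations and monotone cofinal maps *)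

(** The final clause, minimality of [g j], is what lets one enumeration be bounded by another. *)
Lemma exists_greedy (X : set W) (c : W -> W) : unbounded X ->
  exists g : W -> W, forall j, [/\ X (g j), c j < g j, forall k, k < j -> g k < g j &
    forall y, X y -> c j < y -> (forall k, k < j -> g k < y) -> g j <= y].
Proof.
move=> Xu; pose R j (g : W -> W) t := [/\ X t, c j < t, forall k, k < j -> g k < t &
    forall y, X y -> c j < y -> (forall k, k < j -> g k < y) -> t <= y].
have [||g gP] := @exists_wf_rec W w1 R; last by exists g.
- move=> j f g t fg [Xt ct ft tle]; split=> // [k kj|y Xy cy gy].
    by rewrite -fg//; exact: ft.
  by apply: tle => // k kj; rewrite fg//; exact: gy.
- move=> j g; have [b gb] := omega2_bounded g (seg j).
  have [y Xy] := Xu (Order.max b (c j)); rewrite gt_max => /andP[by_ cy].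
  have [|t [Xt ct gt] tle] := @exists_least
      [set t | [/\ X t, c j < t & forall k, k < j -> g k < t]].
    by exists y; split=> // k kj; exact: lt_trans (gb _ kj) by_.
  by exists t; split=> // z Xz cz gz; apply: tle.
Qed.

(** Let [u] enumerate a cofinal subset of [a] and [m] number the elements of [e]. Then [c j] is the
    least upper bound of the [u n] for which all elements of [e] numbered at most [n] lie below [j].
    Such [n] are less than [m j], so [c j < a]; as [j] grows they increase and exhaust the naturals,
    since [e] is a limit. *)
Lemma exists_monotone_cofinal e a : limit_ordinal e -> countable (below e) ->
  has_cof a [set: nat] ->
  exists c : W -> W, [/\ forall j, j < e -> c j < a,
    forall j k, k <= j -> j < e -> c k <= c j &
    forall x, x < a -> exists2 j, j < e & x <= c j].
Proof.
move=> [[e0 e0e] le] ce [[A [[Aa Acof]]]] /card_set_bijP[f [_ finj fsurj]] _.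
have /choice[u uP] n : exists y, A y /\ f y = n.
  by have [y Ay fy] := fsurj n I; exists y.
have ua n : u n < a by apply: Aa; case: (uP n).
have /countable_injP[m minj] := ce.
pose N j n := forall k, k < e -> (m k <= n)%N -> k < j.
have Nex n : exists2 j, j < e & N j n.
  suff [j je jP] : exists2 j, j < e & forall k, k < e -> (m k < n.+1)%N -> k < j.
    by exists j.
  elim: n.+1 => [|p [j je jP]]; first by exists e0.
  have [[k [ke mk]]|nk] := pselect (exists k, k < e /\ m k = p).
    have [j' kj' j'e] := le _ ke; exists (Order.max j j').
      by rewrite gt_max je.
    move=> k' k'e; rewrite ltnS leq_eqVlt => /orP[/eqP mk'|mk']; last first.
      by rewrite lt_max jP.
    have -> : k' = k by apply: minj; rewrite ?inE// mk.
    by rewrite lt_max kj' orbT.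
  exists j => // k ke; rewrite ltnS leq_eqVlt => /orP[/eqP mk|]; last exact: jP.
  by case: nk; exists k.
have Nm j n : j < e -> N j n -> (n < m j)%N.
  by move=> je Njn; rewrite ltnNge; apply/negP => /(Njn _ je); rewrite ltxx.
have umax n : exists2 y, y < a & forall k, (k < n)%N -> u k <= y.
  elim: n => [|n [y ya yu]]; first by exists (u 0%N).
  exists (Order.max y (u n)); first by rewrite gt_max ya ua.
  move=> k; rewrite ltnS leq_eqVlt le_max => /orP[/eqP->|/yu->//].
  by rewrite lexx orbT.
have /choice[c cP] j : exists y, j < e -> (forall n, N j n -> u n <= y) /\
    (forall y', (forall n, N j n -> u n <= y') -> y <= y').
  have [je|ej] := ltP j e; last by exists j.
  have [|y yP ymin] := @exists_least [set y | forall n, N j n -> u n <= y].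
    by have [y _ yu] := umax (m j); exists y => n Njn; apply: yu; exact: Nm.
  by exists y.
exists c; split.
- move=> j je; have [y ya yu] := umax (m j); apply: le_lt_trans ya.
  by apply: (cP j je).2 => n Njn; apply: yu; exact: Nm.
- move=> j k kj je; have ke := le_lt_trans kj je.
  apply: (cP k ke).2 => n Nkn; apply: (cP j je).1 => l lE ml.
  exact: lt_le_trans (Nkn l lE ml) kj.
- move=> x /Acof[y Ay xy]; have [j je Njn] := Nex (f y).
  have uy : u (f y) = y by apply: finj; rewrite ?inE//; case: (uP (f y)).
  by exists j => //; apply: le_trans xy _; rewrite -{1}uy; exact: (cP j je).1.
Qed.

(** * Club guessing along [S] *)

Section ClubGuessing.
Context {S : set W} {e : W}.
Hypothesis Scof : S `<=` [set a | has_cof a [set: nat]].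
Hypothesis Sstat : stationary S.
Hypothesis elimit : limit_ordinal e.
Hypothesis ecount : countable (below e).

Lemma stationary_closure_points h : exists2 a, S a & closure_points h a.
Proof. by have [a [Sa ha]] := Sstat (closure_points_club h); exists a. Qed.

Lemma stationary_unbounded h : unbounded (S `&` closure_points h).
Proof.
move=> x.
have [a Sa Ca] := stationary_closure_points (fun y => Order.max (h y) x).
exists a.
  by split=> //; apply: closure_points_le Ca => y; rewrite le_max lexx.
case: Ca => -[[y ya] _] /(_ _ ya); rewrite gt_max => /andP[//].
Qed.

(* A greedy enumeration of [S `&` closure_points h] steered to be cofinal in
   [a] stays below [a], because it is bounded by a greedy enumeration with a
   constant start, and [a] is closed under the bounds of those. *)
Lemma exists_cofinal_embedding h : exists a, [/\ S a, closure_points h a &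
  cofinal_embedding ((S `&` closure_points h) `&` below a) e a].
Proof.
set X := S `&` closure_points h; have Xu : unbounded X by exact: stationary_unbounded.
have /choice[g gP] x := exists_greedy (fun=> x) Xu.
have /choice[h1 h1P] x := omega2_bounded (g x) (seg e).
have [a Sa Ca] := stationary_closure_points (fun y => Order.max (h y) (h1 y)).
have Cha : closure_points h a.
  by apply: closure_points_le Ca => y; rewrite le_max lexx.
exists a; split=> //.
have [c [ca cmono ccof]] := exists_monotone_cofinal elimit ecount (Scof Sa).
have [q qP] := exists_greedy c Xu.
exists q; split.
- move=> j je; split; first by case: (qP j).
  apply: (@lt_trans _ _ (h1 (c j))); last first.
    by case: Ca => _ /(_ _ (ca j je)); rewrite gt_max => /andP[].
  apply: (le_lt_trans _ (h1P (c j) j je)).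
  (* By induction on [k]: since [c k <= c j], the value [g (c j) k] is a candidate for [q k], which
     is the least candidate. *)
  suff: forall k, k <= j -> q k <= g (c j) k by apply.
  elim/(well_founded_ind wf) => k IH kj; have [_ _ _] := qP k; apply.
  + by case: (gP (c j) k).
  + by have [_ + _ _] := gP (c j) k; apply: le_lt_trans; exact: cmono.
  + move=> l lk; have [_ _ /(_ l lk) gl _] := gP (c j) k.
    by apply: le_lt_trans gl; apply: IH => //; exact/ltW/(lt_le_trans lk).
- by move=> j k jk ke; have [_ _ + _] := qP k; apply.
- move=> x /ccof[j je xc]; exists j => //; apply: (le_trans xc).
  by have [_ /ltW] := qP j.
Qed.

(* Otherwise, choosing counterexamples [next (h k)] along [h k], k < omega_1,
   the sets [A a `&` closure_points (h k)] would be strictly decreasing for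
   some [a], although [A a] is countable. *)
Lemma exists_stable_closure_points (A : W -> set W) (P : set W -> set W) :
  (forall a, countable (A a)) ->
  (forall B B' a, B `<=` B' -> P B a -> P B' a) ->
  (forall h, exists a, [/\ S a, closure_points h a & P (A a `&` closure_points h) a]) ->
  exists h, forall h', exists a, [/\ S a, closure_points h' a,
    P (A a `&` closure_points h) a & A a `&` closure_points h `<=` closure_points h'].
Proof.
move=> cA Pmono Pex; apply: contrapT => nst.
have /choice[next nextP] h : exists h', (forall x, h x <= h' x) /\
    forall a, S a -> closure_points h' a -> P (A a `&` closure_points h) a ->
      ~ (A a `&` closure_points h `<=` closure_points h').
  have /existsNP[h' nh'] : ~ forall h', exists a, [/\ S a, closure_points h' a,
      P (A a `&` closure_points h) a & A a `&` closure_points h `<=` closure_points h'].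
    by move=> H; apply: nst; exists h.
  have hm : closure_points (fun x => Order.max (h x) (h' x)) `<=` closure_points h'.
    by apply: closure_points_le => x; rewrite le_max lexx orbT.
  exists (fun x => Order.max (h x) (h' x)); split=> [x|a Sa Ca Pa Aa].
    by rewrite le_max lexx.
  by apply: nh'; exists a; split=> //; [exact: hm|move=> x /Aa/hm].
have [||H HP] := @exists_wf_rec (W -> W) id
    (fun k f t => forall l, l < k -> forall x, next (f l) x <= t x).
- by move=> k f g t fg ft l lk x; rewrite -fg//; exact: ft.
- move=> k f; have [t tP] := closure_bound (fun l => next (f l)) (seg k).
  by exists t => l lk x; exact: tP.
(* Being a closure point of [H w1], this [a] is one of every [next (H k)] with [k < w1], so each
   stage omits a point [z k] of [A a]. *)
have [a [Sa Ca Pa]] := Pex (H w1).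
have /choice[z zP] k : exists z, k < w1 -> [/\ A a z, closure_points (H k) z &
    ~ closure_points (next (H k)) z].
  have [kw|wk] := ltP k w1; last by exists k.
  have Hk x : next (H k) x <= H w1 x by exact: HP.
  have [nk1 nk2] := nextP (H k).
  have /existsNP[z /not_implyP[[Az Cz] nz]] :
      ~ (A a `&` closure_points (H k) `<=` closure_points (next (H k))).
    apply: nk2 => //; first exact: closure_points_le Ca.
    apply: Pmono Pa; apply: setIS; apply: closure_points_le => x.
    exact: le_trans (nk1 x) (Hk x).
  by exists z.
case: omw1 => + _; apply; apply: sub_countable (cA a).
apply: (@inj_card_le _ _ _ _ z) => [k kw|]; first by case: (zP k kw).
(* [z l] survives at stage [l], hence is a closure point of [next (H k)], whereas [z k] is not. *)
have zlt k l : k < l -> l < w1 -> z k <> z l.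
  move=> kl lw zkl; have [_ _] := zP k (lt_trans kl lw); apply.
  have [_ + _] := zP l lw; rewrite -zkl; apply: closure_points_le => x.
  exact: HP.
move=> k l kw lw zkl; case: (ltgtP k l) => // kl; first by case: (zlt k l).
by case: (zlt l k).
Qed.

Lemma club_guessing : exists C : W -> set W,
  [/\ coherent C, forall a, C a `<=` S, forall a, otp_le (C a) e &
    forall h, exists a, [/\ S a, closure_points h a, isLub (C a) a,
      has_otp (C a) e & C a `<=` closure_points h]].
Proof.
have [A [coA cA Acov]] := exists_partial_squares.
have [|h|i iw iP] := @exists_uniform_index (fun i h => exists a,
    [/\ S a, closure_points h a & cofinal_embedding (A i a `&` S `&` closure_points h) e a]).
- move=> i h h' hh' [a [Sa Ca Pa]]; exists a; split=> //.
    exact: closure_points_le Ca.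
  by apply: cofinal_embeddingS Pa; apply: setIS; exact: closure_points_le.
- have [a [Sa Ca [q [qA qmono qcof]]]] := exists_cofinal_embedding h.
  have [||i iw Bi] := Acov a (q @` below e).
  + exact: card_le_trans (card_image_le _ _) ecount.
  + by move=> _ [j je <-]; case: (qA j je).
  exists i => //; exists a; split=> //; exists q; split=> // j je.
  have [[Sq Cq] _] := qA j je; split=> //; split=> //.
  by apply: Bi; exists j.
have [a|B B' a|h0 h0P] := exists_stable_closure_points
    (A := fun a => A i a `&` S) (P := fun B a => cofinal_embedding B e a) _ _ iP.
- apply: sub_countable (cA i a iw); by apply: subset_card_le => x [].
- exact: cofinal_embeddingS.
set D := fun a => A i a `&` S `&` closure_points h0.
have coD : coherent D by do 2!apply: coherent_setI; exact: coA.
have [|rk rkP] := exists_rank coD.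
  move=> a; apply: sub_countable (cA i a iw).
  by apply: subset_card_le => x [[]].
have [|h|m mw mP] := @exists_uniform_index (fun m h => exists a,
    [/\ S a, closure_points h a, rk a = m, cofinal_embedding (D a) e a &
        D a `<=` closure_points h]).
- move=> m h h' hh' [a [Sa Ca ra Pa Da]]; have hh := closure_points_le hh'.
  by exists a; split=> //; [exact: hh|move=> x /Da/hh].
- have [a [Sa Ca Pa Da]] := h0P h; exists (rk a); last by exists a.
  by case: (rkP a).
(* Any one guessing point [a] provides [q]: take the ranks of a cofinal sequence of type [e] in
   [D a], as ranks map [D a] increasingly onto [m]. *)
have [q [qm qmono qcof]] : exists q : W -> W, [/\ forall j, j < e -> q j < m,
    forall j k, j < k -> k < e -> q j < q k &
    forall x, x < m -> exists2 j, j < e & x <= q j].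
  have [a [_ _ ra [q [qD qmono qcof]] _]] := mP id.
  have [_ rlt rmono rsurj] := rkP a.
  exists (rk \o q); split=> [j je|j k jk ke|x]; rewrite /= -?ra.
  - by apply: rlt; exact: qD.
  - by apply: rmono; [apply: qD; exact: lt_trans ke|exact: qD|exact: qmono].
  - move=> /rsurj[b Db <-]; have [j je] := qcof b (coD _ _ Db).1.
    rewrite le_eqVlt => /orP[/eqP->|bq]; exists j => //.
    by apply/ltW/rmono => //; exact: qD.
have qinj j k : j < e -> k < e -> q j = q k -> j = k.
  move=> je ke qjk; case: (ltgtP j k) => // jk.
    by have := qmono _ _ jk ke; rewrite qjk ltxx.
  by have := qmono _ _ jk je; rewrite qjk ltxx.
(* Membership in [X] depends on [b] alone, so intersecting with [X] keeps coherence. *)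
pose X := [set b | exists2 j, j < e & rk b = q j].
(* The ranks of elements of [D a] in [X] are exactly the [q j] below [rk a]; sending an element to
   its index [j] is the isomorphism onto [k]. *)
have otpC a k : (forall j, j < k <-> j < e /\ q j < rk a) -> has_otp (D a `&` X) k.
  move=> kP; have [_ rlt rmono rsurj] := rkP a.
  have /choice[p pP] b : exists j, X b -> j < e /\ rk b = q j.
    have [[j je jP]|nX] := pselect (X b); last by exists b.
    by exists j.
  have plt b c : D a b -> X b -> D a c -> X c -> b < c -> p b < p c.
    move=> Db /pP[pbe pb] Dc /pP[pce pc] /(rmono _ _ Db Dc); rewrite pb pc => qq.
    case: (ltgtP (p b) (p c)) => // [/qmono/(_ pbe)|ppe].
      by move=> /(lt_trans qq); rewrite ltxx.
    by rewrite ppe ltxx in qq.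
  exists p; split.
    split.
    - move=> b [Db /pP[pbe pb]]; apply/kP; split=> //; rewrite -pb; exact: rlt.
    - move=> b c; rewrite !inE => -[Db Xb] [Dc Xc] pbc.
      case: (ltgtP b c) => // bc.
        by have := plt _ _ Db Xb Dc Xc bc; rewrite pbc ltxx.
      by have := plt _ _ Dc Xc Db Xb bc; rewrite pbc ltxx.
    - move=> j /kP[je /rsurj[b Db rb]].
      have Xb : X b by exists j.
      exists b => //; have [pbe pb] := pP b Xb; apply: qinj => //.
      by rewrite -pb.
  move=> b c [Db Xb] [Dc Xc]; case: (ltgtP b c) => [bc|cb|->].
  - exact: plt.
  - by apply/negbTE; rewrite -leNgt; exact/ltW/plt.
  - by rewrite ltxx.
exists (fun a => D a `&` X); split.
- exact: coherent_setI.
- by move=> a b [[[]]].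
(* The set of failing indices is upward closed because [q] increases, and it contains [e]; its least
   element is the order type. *)
- move=> a; have [|k nk kmin] := @exists_least [set k | ~ (k < e /\ q k < rk a)].
    by exists e; rewrite /= ltxx => -[].
  exists k.
    by apply: kmin; rewrite /= ltxx => -[].
  apply: otpC => j; split=> [jk|[je qj]].
    by apply: contrapT => nj; have := kmin _ nj; rewrite leNgt jk.
  rewrite ltNge; apply/negP => kj; apply: nk; split; first exact: le_lt_trans je.
  move: kj; rewrite le_eqVlt => /orP[/eqP->//|kj].
  exact: lt_trans (qmono _ _ kj je) qj.
- move=> h; have [a [Sa Ca ra [r [rD rmon rcof]] Da]] := mP h.
  have [_ rlt rmono rsurj] := rkP a.
  exists a; split=> //; last by move=> x [/Da].
  + split=> [b [/coD[/ltW]]//|y yub].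
    (* An upper bound [y < a] would lie below some [r k] in [D a]. Cofinality of [q] in [m = rk a]
       gives [q l] at least the rank of [r k], and the element of [D a] of rank [q l] is in [X] and
       exceeds [y]. *)
    rewrite leNgt; apply/negP => /rcof[j je yr].
    have [k jk ke] := elimit.2 _ je.
    have yrk := le_lt_trans yr (rmon _ _ jk ke).
    have Drk := rD k ke.
    have [l lE rql] : exists2 l, l < e & rk (r k) <= q l.
      by apply: qcof; rewrite -ra; exact: rlt.
    have [b Db rb] : exists2 b, D a b & rk b = q l.
      by apply: rsurj; rewrite ra; exact: qm.
    have : b <= y by apply: yub; split=> //; exists l.
    rewrite leNgt => /negP; apply; apply: lt_le_trans yrk _.
    rewrite leNgt; apply/negP => /(rmono _ _ Db Drk).
    by rewrite rb ltNge rql.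
  + apply: otpC => j; rewrite ra; split=> [je|[]//]; split=> //; exact: qm.
Qed.

End ClubGuessing.
End WellOrder.
End Omega2.

Theorem claim22p2 (d : Order.disp_t) (W : orderType d)
    (hW : order_type_omega2 W)
    (omega1 : W) (homega1 : is_omega1 omega1)
    (dstar : W) (hdstar : (dstar < omega1)%O) (hlim : limit_ordinal dstar)
    (S : set W)
    (hS : (S `<=` [set delta : W | has_cof delta [set: nat]])%classic)
    (hstat : stationary S) :
  exists C : W -> set W,
    (forall alpha : W, S alpha ->
      [/\ (C alpha `<=` S)%classic,
          (C alpha `<=` below alpha)%classic,
          (forall beta : W, C alpha beta ->
             S beta /\ C beta = (C alpha `&` below beta)%classic)
        & otp_le (C alpha) dstar])
    /\
    (forall E : set W, club E ->
      stationary [set delta : W | [/\ S delta, isLub (C delta) delta,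
                                     has_otp (C delta) dstar
                                   & (C delta `<=` E)%classic]]%classic).
Proof.
have [wf [w1 [omw1 big seg]]] := hW.
have dw : (dstar < w1)%O by rewrite -(is_omega1_inj omw1 homega1).
have [C [coC CS Cotp Cguess]] :=
  club_guessing wf omw1 big seg hS hstat hlim (countable_below omw1 dw).
exists C; split.
  move=> a _; split=> //; first by move=> b /coC[].
  by move=> b Cab; split; [exact: CS Cab|exact: (coC _ _ Cab).2].
move=> E /club_closure_points[hE hEP] F /club_closure_points[hF hFP].
(* Guessing at the maximum of both functions puts [a] itself in the test club [F] and [C a] inside
   [E]. *)
have [a [Sa Ca lubC otpC Ch]] := Cguess (fun x => Order.max (hE x) (hF x)).
exists a; split.
  split=> // x /Ch Cx; apply: hEP; apply: closure_points_le Cx => y.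
  by rewrite le_max lexx.
apply: hFP; apply: closure_points_le Ca => y.
by rewrite le_max lexx orbT.
Qed.
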